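(* Let $\mathcal{D}$ be a set of $n$ unit disks (disks of radius one) in the plane. One can compute, in $O(n)$ time, a $(1/2)$-approximate matching for $\mathcal{I}_{\mathcal{D}}$, where $\mathcal{I}_{\mathcal{D}}$ is the intersection graph of the disks of $\mathcal{D}$.
   Context: The input to the algorithm is the set of disks (given by their centers), not the graph. The intersection graph $\mathcal{I}_{\mathcal{D}}$ has vertex set $\mathcal{D}$, with an edge between two distinct disks if and only if they intersect. A matching in a graph is a set of edges no two of which share an endpoint; $m^\star(G)$ denotes the maximum cardinality of a matching in $G$. For $\beta\in[0,1]$, a $\beta$-matching (or $\beta$-approximate matching) of $G$ is a matching $B$ with $|B|\ge \beta\, m^\star(G)$. Model of computation: real RAM with unit-cost arithmetic, floor function and hashing (hash table operations take constant (expected) time). *)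

(* Defs.v *)
From HB Require Import structures.
From mathcomp Require Import all_boot all_order all_algebra finmap.
From mathcomp Require Import all_classical all_reals all_analysis.
Set Implicit Arguments.
Unset Strict Implicit.
Unset Printing Implicit Defensive.
Import Order.TTheory GRing.Theory Num.Theory.
Local Open Scope classical_set_scope.
Local Open Scope ring_scope.

(** * Matchings in finite graphs *)

Section Graphs.
Variable T : finType.

(* A simple graph on [T] is given by its adjacency relation. *)
Definition edges (e : rel T) : {set {set T}} :=
  [set [set p.1; p.2]%SET | p in [set p : T * T | e p.1 p.2]%SET]%SET.

Definition is_matching (e : rel T) (M : {set {set T}}) : bool :=
  (M \subset edges e) && finset.trivIset M.

Definition matching_number (e : rel T) : nat :=
  (\max_(M : {set {set T}} | is_matching e M) #|M|)%N.

Definition approx_matching (R : realType) (beta : R) (e : rel T)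
    (B : {set {set T}}) : Prop :=
  is_matching e B /\ beta * (matching_number e)%:R <= #|B|%:R.

End Graphs.

(** * Intersection graphs of unit disks *)

Section Disks.
Variable R : realType.

(* The library norm on [R * R] is the max norm, hence this definition. *)
Definition edist (p q : R * R) : R :=
  Num.sqrt ((p.1 - q.1) ^+ 2 + (p.2 - q.2) ^+ 2).

Definition unit_disk (c : R * R) : set (R * R) := [set p | edist p c <= 1].

(* The disks are listed by their centers; vertex [i] is the [i]-th disk. *)
Definition intersection_graph (n : nat) (D : n.-tuple (R * R)) : rel 'I_n :=
  [rel i j | (i != j) &&
     `[< unit_disk (tnth D i) `&` unit_disk (tnth D j) !=set0 >]].

End Disks.

(** * The real RAM with floor function and hashing

  A machine has registers, arrays and hash tables, each kind named by natural
  numbers. All of them hold real numbers. Programs do not depend on the input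
  or its size, and their only constants are integers. An array is a finite
  sequence that grows one cell at a time, so only the hash tables are sparse.
  Their keys are pairs of integers. *)

Inductive expr : Type :=
| Const of int
| Reg of nat
| Add of expr & expr
| Sub of expr & expr
| Mul of expr & expr
| Div of expr & expr
| Floor of expr
| Read of nat & expr               (* array, index *)
| Lookup of nat & expr & expr.     (* table, key *)

Inductive test : Type :=
| Le of expr & expr
| Lt of expr & expr.

Inductive instr : Type :=
| Assign of nat & expr             (* register, value *)
| Write of nat & expr & expr       (* array, index, value *)
| Push of nat & expr               (* array, value appended at its end *)
| Insert of nat & expr & expr & expr (* table, key, value *)
| Delete of nat & expr & expr.     (* table, key *)

Inductive cmd : Type :=
| Skip
| Do of instr
| Seq of cmd & cmd
| If of test & cmd & cmd
| While of test & cmd.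

(* Costs: [*_ops] counts the elementary operations other than hash table
   operations, and [*_hops] counts the hash table operations. *)

Fixpoint expr_ops (e : expr) : nat :=
  match e with
  | Const _ | Reg _ => 1
  | Add a b | Sub a b | Mul a b | Div a b => (expr_ops a + expr_ops b).+1
  | Floor a | Read _ a => (expr_ops a).+1
  | Lookup _ a b => expr_ops a + expr_ops b
  end%N.

Fixpoint expr_hops (e : expr) : nat :=
  match e with
  | Const _ | Reg _ => 0
  | Add a b | Sub a b | Mul a b | Div a b => expr_hops a + expr_hops b
  | Floor a | Read _ a => expr_hops a
  | Lookup _ a b => (expr_hops a + expr_hops b).+1
  end%N.

Definition test_ops (b : test) : nat :=
  match b with Le x y | Lt x y => (expr_ops x + expr_ops y).+1 end%N.

Definition test_hops (b : test) : nat :=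
  match b with Le x y | Lt x y => expr_hops x + expr_hops y end%N.

Definition instr_ops (c : instr) : nat :=
  match c with
  | Assign _ a | Push _ a => (expr_ops a).+1
  | Write _ a b => (expr_ops a + expr_ops b).+1
  | Insert _ a b v => expr_ops a + expr_ops b + expr_ops v
  | Delete _ a b => expr_ops a + expr_ops b
  end%N.

Definition instr_hops (c : instr) : nat :=
  match c with
  | Assign _ a | Push _ a => expr_hops a
  | Write _ a b => expr_hops a + expr_hops b
  | Insert _ a b v => (expr_hops a + expr_hops b + expr_hops v).+1
  | Delete _ a b => (expr_hops a + expr_hops b).+1
  end%N.

Section Semantics.
Variable R : realType.

Record state : Type := State {
  reg : nat -> R;
  arr : nat -> seq R;
  tab : nat -> {fmap (int * int)%type -> R} }.

(* Indices and keys are rounded down to integers. Reading outside an array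
   or at an absent key yields 0, and writing outside an array has no effect. *)

Definition get (a : seq R) (i : R) : R :=
  if Num.floor i is Posz k then nth 0 a k else 0.

Definition put (a : seq R) (i v : R) : seq R :=
  if Num.floor i is Posz k then
    if (k < size a)%N then set_nth 0 a k v else a
  else a.

Definition key (x y : R) : int * int := (Num.floor x, Num.floor y).

Fixpoint eval (s : state) (e : expr) : R :=
  match e with
  | Const z => z%:~R
  | Reg x => reg s x
  | Add a b => eval s a + eval s b
  | Sub a b => eval s a - eval s b
  | Mul a b => eval s a * eval s b
  | Div a b => eval s a / eval s b
  | Floor a => (Num.floor (eval s a))%:~R
  | Read m a => get (arr s m) (eval s a)
  | Lookup h a b => odflt 0 (tab s h).[? key (eval s a) (eval s b)]%fmap
  end.

Definition holds (s : state) (b : test) : bool :=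
  match b with
  | Le x y => eval s x <= eval s y
  | Lt x y => eval s x < eval s y
  end.

Definition upd (A : Type) (f : nat -> A) (i : nat) (v : A) : nat -> A :=
  fun j => if j == i then v else f j.

Definition apply_instr (c : instr) (s : state) : state :=
  match c with
  | Assign x a => State (upd (reg s) x (eval s a)) (arr s) (tab s)
  | Write m a b =>
      State (reg s) (upd (arr s) m (put (arr s m) (eval s a) (eval s b)))
        (tab s)
  | Push m a =>
      State (reg s) (upd (arr s) m (rcons (arr s m) (eval s a))) (tab s)
  | Insert h a b v =>
      State (reg s) (arr s)
        (upd (tab s) h
          (tab s h).[key (eval s a) (eval s b) <- eval s v]%fmap)
  | Delete h a b =>
      State (reg s) (arr s)
        (upd (tab s) h (tab s h).[~ key (eval s a) (eval s b)]%fmap)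
  end.

(* [exec p s t h s']: started in [s], the program [p] halts in [s'] after [t]
   elementary operations and [h] hash table operations. *)
Inductive exec : cmd -> state -> nat -> nat -> state -> Prop :=
| exec_skip s : exec Skip s 1 0 s
| exec_do c s : exec (Do c) s (instr_ops c) (instr_hops c) (apply_instr c s)
| exec_seq p q s t h s1 t' h' s2 :
    exec p s t h s1 -> exec q s1 t' h' s2 ->
    exec (Seq p q) s (t + t')%N (h + h')%N s2
| exec_if b p q s t h s' :
    exec (if holds s b then p else q) s t h s' ->
    exec (If b p q) s (test_ops b + t)%N (test_hops b + h)%N s'
| exec_while_false b p s :
    ~~ holds s b -> exec (While b p) s (test_ops b) (test_hops b) s
| exec_while_true b p s t h s1 t' h' s2 :
    holds s b -> exec p s t h s1 -> exec (While b p) s1 t' h' s2 ->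
    exec (While b p) s (test_ops b + t + t')%N (test_hops b + h + h')%N s2.

Lemma exec_det p s t h s1 t' h' s2 :
  exec p s t h s1 -> exec p s t' h' s2 -> [/\ t = t', h = h' & s1 = s2].
Proof.
move=> H; elim: H t' h' s2 => {p s t h s1}.
- by move=> s t' h' s2 H; inversion H; subst.
- by move=> c s t' h' s2 H; inversion H; subst.
- move=> p q s t h s1 ta ha sa _ IH1 _ IH2 t' h' s2 H; inversion H; subst.
  have [<- <- E] := IH1 _ _ _ H2; subst.
  by have [<- <- <-] := IH2 _ _ _ H7.
- move=> b p q s t h s' _ IH t' h' s2 H; inversion H; subst.
  by have [<- <- <-] := IH _ _ _ H7.
- move=> b p s Nb t' h' s2 H; inversion H; subst => //.
  by move: Nb; rewrite (_ : holds s b = true).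
- move=> b p s t h s1 ta ha sa Hb _ IH1 _ IH2 t' h' s2 H; inversion H; subst.
    by move: Hb; rewrite (negbTE (_ : ~~ holds s2 b)).
  match goal with K : exec p _ _ _ _ |- _ => have [<- <- E] := IH1 _ _ _ K end.
  by subst; match goal with K : exec (While _ _) _ _ _ _ |- _ =>
    have [<- <- <-] := IH2 _ _ _ K end.
Qed.

(* Register 0 holds the number of disks, and arrays 0 and 1 hold the x- and
   y-coordinates of their centers. Everything else is zero or empty. *)
Definition input (n : nat) (D : n.-tuple (R * R)) : state :=
  State (upd (fun=> 0) 0%N n%:R)
        (upd (upd (fun=> [::]) 0%N [seq c.1 | c <- D]) 1%N [seq c.2 | c <- D])
        (fun=> [fmap]%fmap).

(* On termination, arrays 2 and 3 list without repetition the edges of [B]: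
   the endpoints of the k-th edge are the disks numbered by their k-th cells. *)
Definition outputs (n : nat) (s : state) (B : {set {set 'I_n}}) : Prop :=
  exists l : seq ('I_n * 'I_n),
    [/\ arr s 2 = [seq (nat_of_ord p.1)%:R | p <- l],
        arr s 3 = [seq (nat_of_ord p.2)%:R | p <- l],
        uniq [seq [set p.1; p.2]%SET | p <- l]
      & B = [set:: [seq [set p.1; p.2]%SET | p <- l]]%SET].

(* Elementary operations take unit time. The [j]-th hash table operation of a
   run takes random time [X j], whose expectation is at most [kappa]. *)
Definition hash_costs (kappa : R) (d : measure_display) (T : measurableType d)
    (P : probability T R) (X : nat -> {RV P >-> R}) : Prop :=
  forall j, (forall w, 0 <= X j w) /\ ('E_P[X j] <= kappa%:E)%E.

Definition expected_time (d : measure_display) (T : measurableType d)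
    (P : probability T R) (X : nat -> {RV P >-> R}) (t h : nat) : \bar R :=
  ('E_P[fun w => (t%:R + \sum_(j < h) X j w)%R])%E.

End Semantics.

(* Main.v *)
(** Greedy algorithm: scan the disks in order and match each one with some
   earlier, still unmatched disk that it intersects, if there is one. The
   matching obtained is maximal, and every edge of any other matching meets one
   of its vertices, so it has at least half the maximum size.

   For the running time, hash the unmatched disks seen so far by the cell of
   their center in the grid of side 1. Two disks with centers in the same cell
   intersect, so each cell holds at most one unmatched disk, and the disks that
   intersect a given one lie in the 25 cells around its own: a step takes
   constant time. *)

Require Import Defs.
From mathcomp Require Import all_boot all_order all_algebra.
From mathcomp Require Import all_classical all_reals all_analysis.
From mathcomp Require Import measurable_realfun finmap ring lra zify.
Set Implicit Arguments.
Unset Strict Implicit.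
Unset Printing Implicit Defensive.
Import Order.TTheory GRing.Theory Num.Theory.
Local Open Scope ring_scope.

(** * Matchings, their covers and maximality *)

Section Matchings.
Variables (T : finType) (e : rel T).
Implicit Type M : {set {set T}}.

Lemma cover_setU1 (A : {set T}) M :
  finset.cover (A |: M)%SET = (A :|: finset.cover M)%SET.
Proof. by rewrite /finset.cover finset.bigcup_setU finset.big_set1. Qed.

Lemma matching_edge M A : is_matching e M -> A \in M ->
  exists u v, e u v /\ A = [set u; v]%SET.
Proof.
move=> /andP[/fintype.subsetP sM _] /sM /imsetP[[u v]]; rewrite inE /= => euv ->.
by exists u, v.
Qed.

Lemma is_matching0 : is_matching e finset.set0.
Proof.
rewrite /is_matching finset.sub0set /=; apply/finset.trivIsetP => A B.
by rewrite inE.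
Qed.

(** An edge with uncovered endpoints is disjoint from every member of [M]. The second conclusion
    later keeps the output list of edges free of repetitions. *)
Lemma is_matchingU1 M u v : is_matching e M -> e u v ->
  u \notin finset.cover M -> v \notin finset.cover M ->
  is_matching e ([set u; v] |: M)%SET /\ [set u; v]%SET \notin M.
Proof.
move=> mM euv uM vM; have /andP[sM tM] := mM.
have [||tUM uvM] := @trivIsetU1 T [set u; v]%SET M _ tM.
- move=> B BM; rewrite -setI_eq0; apply/eqP/setP => x; rewrite !inE.
  apply/negP => /andP[/orP[] /eqP -> xB].
    by move/bigcupP: uM; apply; exists B.
  by move/bigcupP: vM; apply; exists B.
(* The empty set is not a member of [M], since edges are nonempty. *)
- apply/negP => /(matching_edge mM)[x [y [_ /setP/(_ x)]]].
  by rewrite !inE eqxx.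
split=> //; rewrite /is_matching tUM andbT finset.subUset sM andbT finset.sub1set.
by apply/imsetP; exists (u, v) => //; rewrite inE.
Qed.

Lemma leq_card_cover_matching M : is_matching e M ->
  (#|finset.cover M| <= #|M| * 2)%N.
Proof.
move=> mM; apply: leq_trans (leq_card_cover M) _; rewrite -sum_nat_const.
apply: leq_sum => A /(matching_edge mM)[u [v [_ ->]]].
by rewrite cards2; case: (_ != _).
Qed.

(* Each edge of any matching contains a vertex of [cover M], and these vertices
   are pairwise distinct. *)
Lemma maximal_matching_half (R : realType) M : is_matching e M ->
  (forall u v, e u v -> (u \in finset.cover M) || (v \in finset.cover M)) ->
  approx_matching (2^-1 : R) e M.
Proof.
move=> mM maxM; split=> //.
suff : (matching_number e <= #|M| * 2)%N.
  by rewrite -(ler_nat R) natrM => ?; lra.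
apply/bigmax_leqP => N mN; apply: leq_trans _ (leq_card_cover_matching mM).
pose f (A : {set T}) := [pick x in A :&: finset.cover M]%SET.
have fP A : A \in N -> exists x, [/\ f A = Some x, x \in A & x \in finset.cover M].
  move=> /(matching_edge mN)[u [v [euv ->]]]; rewrite /f; case: pickP.
    by move=> x; rewrite inE => /andP[]; exists x.
  move=> none; have := maxM u v euv.
  move: (none u) (none v); rewrite !inE !eqxx orbT /=.
  by move=> -> ->.
have finj : {in N &, injective f}.
  move=> A B AN BN; have [x [-> xA _]] := fP A AN.
  have [y [-> yB _]] := fP B BN; case=> xy; subst y.
  apply: contraTeq isT => AB; have /andP[_ /finset.trivIsetP tN] := mN.
  by have := disjointFr (tN A B AN BN AB) xA; rewrite yB.
(* [f] has option values, so its image is compared with that of [cover M] under [Some]. *)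
rewrite -(card_in_imset finj) -(card_imset (mem (finset.cover M)) (@Some_inj _)).
apply: subset_leq_card; apply/fintype.subsetP => _ /imsetP[A AN ->].
by have [x [-> _ xM]] := fP A AN; apply: imset_f.
Qed.

End Matchings.

(** * Distances between centers and the grid of side 1 *)

Section Geometry.
Variable R : realType.

(* Midpoint in one direction, (a + b)^2 <= 2 (a^2 + b^2) in the other. *)
Lemma unit_disks_intersect (a b : R * R) :
  ((unit_disk a `&` unit_disk b) !=set0)%classic <->
  (a.1 - b.1) ^+ 2 + (a.2 - b.2) ^+ 2 <= 4.
Proof.
have sqrt_le1 (x : R) : 0 <= x -> (Num.sqrt x <= 1) = (x <= 1).
  by move=> x0; rewrite -[X in _ <= X]sqrtr1 ler_sqrt ?ltr01.
split=> [[p []]|ab].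
  rewrite /unit_disk /edist /= !sqrt_le1 ?addr_ge0 ?sqr_ge0 // => pa pb.
  have := sqr_ge0 (p.1 - a.1 + (p.1 - b.1)).
  have := sqr_ge0 (p.2 - a.2 + (p.2 - b.2)).
  nra.
exists ((a.1 + b.1) / 2, (a.2 + b.2) / 2).
rewrite /unit_disk /edist /=; split; rewrite /= sqrt_le1 ?addr_ge0 ?sqr_ge0 //;
  rewrite [leLHS](_ : _ = ((a.1 - b.1) ^+ 2 + (a.2 - b.2) ^+ 2) / 4);
  by [lra | rewrite /=; field].
Qed.

Lemma intersection_graphE n (D : n.-tuple (R * R)) (i j : 'I_n) :
  intersection_graph D i j = (i != j) &&
    (((tnth D i).1 - (tnth D j).1) ^+ 2 +
     ((tnth D i).2 - (tnth D j).2) ^+ 2 <= 4).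
Proof.
rewrite /intersection_graph /=; congr (_ && _).
by apply/asboolP/idP => /unit_disks_intersect.
Qed.

(** The floors differ by less than 3 and are integers. This leaves 5 columns and 5 rows, hence the
    25 cells. *)
Lemma floor_dist_le2 (x y : R) : (x - y) ^+ 2 <= 4 ->
  - 2 <= Num.floor x - Num.floor y <= 2.
Proof.
move=> xy2; have /andP[xy yx] : - 2 <= x - y <= 2.
  by rewrite -ler_norml -(@ler_pXn2r _ 2) ?nnegrE // real_normK ?num_real // expr2; lra.
have /andP[fx xf] := floor_itv x; have /andP[fy yf] := floor_itv y.
have : (- 3)%:~R < (Num.floor x - Num.floor y)%:~R :> R.
  by rewrite rmorphB; move: xf yf; rewrite !intrD; lra.
have : (Num.floor x - Num.floor y)%:~R < 3%:~R :> R.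
  by rewrite rmorphB; move: xf yf; rewrite !intrD; lra.
by rewrite !ltr_int; lia.
Qed.

Lemma eq_floor_dist (x y : R) : Num.floor x = Num.floor y ->
  (x - y) ^+ 2 <= 1.
Proof.
move=> xy; have := floor_itv x; have := floor_itv y.
rewrite xy intrD => /andP[? ?] /andP[? ?]; nra.
Qed.

(** Lets the program shift a cell by adding the offset to the coordinate before the table rounds its
    key. *)
Lemma floorDint (x : R) (z : int) : Num.floor (x + z%:~R) = Num.floor x + z.
Proof. by rewrite floorDrz ?intr_int // intrKfloor. Qed.

Lemma get_nat (a : seq R) k : Defs.get a k%:R = nth 0 a k.
Proof. by rewrite /Defs.get pmulrn intrKfloor. Qed.

End Geometry.

(** * Execution and cost of loop-free programs and of counting loops *)

Fixpoint loop_free (p : cmd) : bool :=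
  match p with
  | Skip | Do _ => true
  | Seq p q | If _ p q => loop_free p && loop_free q
  | While _ _ => false
  end.

(* An upper bound on the elementary and hash table operations together. *)
Fixpoint max_cost (p : cmd) : nat :=
  match p with
  | Skip => 1
  | Do c => instr_ops c + instr_hops c
  | Seq p q => max_cost p + max_cost q
  | If b p q => test_ops b + test_hops b + maxn (max_cost p) (max_cost q)
  | While _ _ => 0
  end%N.

Section Execution.
Variable R : realType.
Implicit Type s : state R.

(** A functional semantics for loop-free programs; the value at [While] is a placeholder. *)
Fixpoint run (p : cmd) s : state R :=
  match p with
  | Skip | While _ _ => s
  | Do c => apply_instr c s
  | Seq p q => run q (run p s)
  | If b p q => if holds s b then run p s else run q s
  end.

Lemma exec_loop_free p s : loop_free p ->
  exists t h, exec p s t h (run p s) /\ (t + h <= max_cost p)%N.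
Proof.
elim: p s => [|c|p IHp q IHq|b p IHp q IHq|//] s /=.
- by exists 1%N, 0%N; split=> //; constructor.
- by exists (instr_ops c), (instr_hops c); split=> //; constructor.
- move=> /andP[/(IHp s)[t [h [ep le_p]]] /(IHq (run p s))[t' [h' [eq le_q]]]].
  by exists (t + t')%N, (h + h')%N; split; [apply: exec_seq ep eq | lia].
- move=> /andP[lp lq].
  have [t [h [er le_r]]] : exists t h,
      exec (if holds s b then p else q) s t h
        (if holds s b then run p s else run q s) /\
      (t + h <= maxn (max_cost p) (max_cost q))%N.
    case: ifP => _.
      by have [t [h [? ?]]] := IHp s lp; exists t, h; split=> //; lia.
    by have [t [h [? ?]]] := IHq s lq; exists t, h; split=> //; lia.
  by exists (test_ops b + t)%N, (test_hops b + h)%N; split; [apply: exec_if | lia].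
Qed.

(** The invariant is indexed by the number of completed rounds. The guard is evaluated [n] times
    with success and once more on exit, whence the last summand. *)
Lemma exec_while b p n (Inv : nat -> state R -> Prop) s : loop_free p ->
  (forall i s, Inv i s -> holds s b = (i < n)%N) ->
  (forall i s, (i < n)%N -> Inv i s -> Inv i.+1 (run p s)) ->
  Inv 0%N s ->
  exists t h s', [/\ exec (While b p) s t h s', Inv n s' &
    (t + h <= (test_ops b + test_hops b + max_cost p) * n
              + (test_ops b + test_hops b))%N].
Proof.
move=> lp Hb Hp; set c := (test_ops b + test_hops b)%N.
(* Induction on the number [k] of rounds left. *)
suff H k i s0 : (k + i = n)%N -> Inv i s0 -> exists t h s',
    [/\ exec (While b p) s0 t h s', Inv n s' &
        (t + h <= (c + max_cost p) * k + c)%N].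
  by apply: H; rewrite addn0.
elim: k i s0 => [|k IH] i s0; [rewrite add0n => -> In | move=> ki Ii].
  exists (test_ops b), (test_hops b), s0; split=> //; last by rewrite /c; lia.
  by apply: exec_while_false; rewrite (Hb _ _ In) ltnn.
have lt_in : (i < n)%N by lia.
have [t [h [ep le_p]]] := exec_loop_free s0 lp.
have [||t' [h' [s' [ew Is' le_w]]]] := IH i.+1 (run p s0); [lia|exact: Hp|].
exists (test_ops b + t + t')%N, (test_hops b + h + h')%N, s'; split=> //.
  by apply: exec_while_true ep ew; rewrite (Hb _ _ Ii).
by rewrite mulnS; move: le_p le_w; rewrite /c; lia.
Qed.

(** Linearity of expectation, through integrals of nonnegative functions. *)
Lemma expected_time_le (kappa : R) (d : measure_display) (T : measurableType d)
    (P : probability T R) (X : nat -> {RV P >-> R}) (t h : nat) :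
  hash_costs kappa X ->
  (expected_time X t h <= (t%:R + h%:R * kappa)%:E)%E.
Proof.
move=> HX; rewrite /expected_time unlock.
under eq_integral do rewrite EFinD -sumEFin.
rewrite ge0_integralD //=; first last.
- by apply: emeasurable_sum => j; apply/measurable_EFinP.
- by move=> w _; apply: sume_ge0 => j _; rewrite lee_fin; case: (HX j).
rewrite integral_cst //= probability_setT mule1.
rewrite ge0_integral_sum //=; first last.
- by move=> j w _; rewrite lee_fin; case: (HX j).
- by move=> j; apply/measurable_EFinP.
rewrite EFinD leeD2l // mulr_natl -[X in (_ *+ X)]card_ord -sumr_const -sumEFin.
apply: lee_sum => j _; have [_] := HX j; by rewrite unlock.
Qed.

(** A single coefficient dominates both unit costs, so that bounding [t + h] suffices. *)
Lemma expected_time_le_max (kappa : R) (d : measure_display)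
    (T : measurableType d) (P : probability T R) (X : nat -> {RV P >-> R})
    (t h : nat) : hash_costs kappa X ->
  (expected_time X t h <= (Num.max 1 kappa * (t + h)%:R)%:E)%E.
Proof.
move=> HX; apply: le_trans (expected_time_le t h HX) _.
rewrite lee_fin natrD mulrDr lerD //.
  by rewrite ler_peMl // le_max lexx.
by rewrite mulrC ler_wpM2r // le_max lexx orbT.
Qed.

End Execution.

(** * The greedy program *)

(* Registers 1, 2, 3 hold the current disk and the coordinates of its center,
   register 4 the found partner plus one, or 0 as long as there is none. Table 0
   likewise stores an unmatched disk [v] as [v + 1], since an absent key reads
   as 0. *)
Definition sqdist_to (v : expr) : expr :=
  let dx := Defs.Sub (Reg 2) (Read 0 v) in let dy := Defs.Sub (Reg 3) (Read 1 v) in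
  Add (Mul dx dx) (Mul dy dy).

(** Register 5 receives the entry of the cell at offset [o], and 0 means that this cell is empty. A
    later success overwrites an earlier one. *)
Definition probe (o : int * int) : cmd :=
  Seq (Do (Assign 5 (Lookup 0 (Add (Reg 2) (Const o.1))
                              (Add (Reg 3) (Const o.2)))))
      (If (Lt (Const 0) (Reg 5))
          (If (Le (sqdist_to (Defs.Sub (Reg 5) (Const 1))) (Const 4))
              (Do (Assign 4 (Reg 5))) Skip) Skip).

Definition scan (os : seq (int * int)) : cmd :=
  foldr (fun o => Seq (probe o)) Skip os.

Definition offsets : seq (int * int) :=
  let r := [:: -2; -1; 0; 1; 2] in [seq (a, b) | a <- r, b <- r].

(** Only the partner is deleted, under the key given by its center: the current disk has not been
    inserted. *)
Definition match_partner : cmd :=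
  let v := Defs.Sub (Reg 4) (Const 1) in
  Seq (Do (Push 2 (Reg 1)))
      (Seq (Do (Push 3 v)) (Do (Delete 0 (Read 0 v) (Read 1 v)))).

Definition step : cmd :=
  Seq (Do (Assign 2 (Read 0 (Reg 1))))
  (Seq (Do (Assign 3 (Read 1 (Reg 1))))
  (Seq (Do (Assign 4 (Const 0)))
  (Seq (scan offsets)
  (Seq (If (Lt (Const 0) (Reg 4)) match_partner
           (Do (Insert 0 (Reg 2) (Reg 3) (Add (Reg 1) (Const 1)))))
       (Do (Assign 1 (Add (Reg 1) (Const 1)))))))).

Definition greedy : cmd := While (Lt (Reg 1) (Reg 0)) step.

Lemma mem_offsets (a b : int) : - 2 <= a <= 2 -> - 2 <= b <= 2 ->
  (a, b) \in offsets.
Proof.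
by move=> a2 b2; apply/allpairsP; exists (a, b); rewrite !inE /=; split=> //; lia.
Qed.

(** * Effect of scanning the neighbouring cells *)

Section Scan.
Variable R : realType.
Implicit Types (s : state R) (o : int * int).

Definition found s o : R :=
  odflt 0 (tab s 0%N).[? (Num.floor (reg s 2%N) + o.1,
                          Num.floor (reg s 3%N) + o.2)]%fmap.

Definition hit s o : bool :=
  (0 < found s o) &&
  ((reg s 2%N - Defs.get (arr s 0%N) (found s o - 1)) ^+ 2 +
   (reg s 3%N - Defs.get (arr s 1%N) (found s o - 1)) ^+ 2 <= 4).

Lemma run_probe s o : let s' := run (probe o) s in
  [/\ arr s' = arr s, tab s' = tab s,
      forall r, (r < 4)%N -> reg s' r = reg s r &
      reg s' 4%N = if hit s o then found s o else reg s 4%N].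
Proof.
have fE : odflt 0 (tab s 0%N).[? Defs.key (reg s 2%N + o.1%:~R)
    (reg s 3%N + o.2%:~R)]%fmap = found s o.
  by rewrite /Defs.key !floorDint.
rewrite /= /upd /= fE /hit -!expr2.
have lt4E r : (r < 4)%N -> (r == 4%N) = false /\ (r == 5%N) = false by lia.
case: ltP => fo /=; last by split=> // r /lt4E[_ ->].
by case: ifP => _; split=> // r /lt4E[r4 r5]; rewrite /= ?r4 r5.
Qed.

Lemma run_scan s os : let s' := run (scan os) s in
  [/\ arr s' = arr s, tab s' = tab s,
      forall r, (r < 4)%N -> reg s' r = reg s r &
      (exists2 o, hit s o & reg s' 4%N = found s o) \/
      (reg s' 4%N = reg s 4%N /\ {in os, forall o, ~~ hit s o})].
Proof.
elim: os s => [|o os IH] s; first by split=> //; right.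
have -> : run (scan (o :: os)) s = run (scan os) (run (probe o) s) by [].
have [arr1 tab1 reg1 r4] := run_probe s o.
move: (run (probe o) s) arr1 tab1 reg1 r4 => s1 arr1 tab1 reg1 r4.
(* A probe changes neither the table, the arrays nor the current center, so later probes see the
   same entries. *)
have foundE x : found s1 x = found s x by rewrite /found tab1 !reg1.
have hitE x : hit s1 x = hit s x by rewrite /hit foundE arr1 !reg1.
have [arr2 tab2 reg2 r4'] := IH s1.
split; rewrite ?arr2 ?tab2 //; first by move=> r ltr; rewrite reg2 ?reg1.
case: r4' => [[x hx ->]|[-> miss]].
  by left; exists x; rewrite -?hitE // foundE.
rewrite r4; case: ifP => [ho|/negbT ho]; first by left; exists o.
right; split=> // x; rewrite inE => /predU1P[-> //|/miss].
by rewrite hitE.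
Qed.

End Scan.

(** * Correctness of the greedy matching and of its hash table *)

Section Greedy.
Variables (R : realType) (n : nat) (D : n.-tuple (R * R)).
Local Notation G := (intersection_graph D).
Implicit Types (i : nat) (u v w : 'I_n) (l : seq ('I_n * 'I_n)).

Lemma intersection_graph_sym u v : G u v = G v u.
Proof.
rewrite !intersection_graphE eq_sym -sqrrN opprB.
by congr (_ && (_ + _ <= _)); rewrite -sqrrN opprB.
Qed.

Definition cell v : int * int := key (tnth D v).1 (tnth D v).2.

(** Each coordinate contributes at most 1 to the squared distance, and 2 is below the threshold
    4. *)
Lemma same_cell_adjacent u v : u != v -> cell u = cell v -> G u v.
Proof.
move=> uv [/eq_floor_dist x1 /eq_floor_dist y1].
by rewrite intersection_graphE uv /=; lra.
Qed.

Lemma adjacent_offset u v : G u v ->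
  ((cell v).1 - (cell u).1, (cell v).2 - (cell u).2) \in offsets.
Proof.
(* Symmetry puts the differences in the order in which the offset takes them. *)
rewrite intersection_graph_sym intersection_graphE => /andP[_ d4].
apply: mem_offsets; apply: floor_dist_le2.
  by apply: le_trans d4; rewrite lerDl sqr_ge0.
by apply: le_trans d4; rewrite lerDr sqr_ge0.
Qed.

Definition edge_seq l : seq {set 'I_n} := [seq [set p.1; p.2]%SET | p <- l].
Definition edge_set l : {set {set 'I_n}} := [set:: edge_seq l]%SET.

Lemma edge_set_rcons l u v :
  edge_set (rcons l (u, v)) = ([set u; v] |: edge_set l)%SET.
Proof.
by apply/setP => A; rewrite /edge_set /edge_seq map_rcons !inE mem_rcons inE.
Qed.

Definition unmatched i l v : bool :=
  (v < i)%N && (v \notin finset.cover (edge_set l)).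

(** The third clause leaves disk [i] free. The last one is maximality among the first [i] disks. *)
Definition greedy_matching i l : Prop :=
  [/\ is_matching G (edge_set l), uniq (edge_seq l),
      forall v, v \in finset.cover (edge_set l) -> (v < i)%N &
      forall u v, unmatched i l u -> unmatched i l v -> ~~ G u v].

Definition indexes (t : {fmap (int * int)%type -> R}) i l : Prop :=
  forall k r, t.[? k]%fmap = Some r <->
    exists v, [/\ unmatched i l v, cell v = k & r = v.+1%:R].

(** A key has a single value, so [u + 1] and [v + 1] coincide. *)
Lemma indexes_inj t i l u v : indexes t i l -> unmatched i l u ->
  unmatched i l v -> cell u = cell v -> u = v.
Proof.
move=> It uu uv uvk; have /It tu : exists w, [/\ unmatched i l w,
  cell w = cell v & u.+1%:R = w.+1%:R :> R] by exists u.
have /It : exists w, [/\ unmatched i l w,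
  cell w = cell v & v.+1%:R = w.+1%:R :> R] by exists v.
rewrite tu => -[/eqP]; rewrite eqr_nat => /eqP[uv']; exact: val_inj.
Qed.

Section Step.
Variables (l : seq ('I_n * 'I_n)) (i : 'I_n).
Hypothesis gl : greedy_matching i l.

Let i_free : i \notin finset.cover (edge_set l).
Proof. by case: gl => _ _ lt _; apply/negP => /lt; rewrite ltnn. Qed.

Lemma unmatched_skip v :
  unmatched i.+1 l v = (v == i) || unmatched i l v.
Proof.
rewrite /unmatched ltnS leq_eqVlt -val_eqE /=.
case: eqP => //= /val_inj ->; exact: i_free.
Qed.

(** The only new pairs of unmatched disks involve [i]. *)
Lemma greedy_matching_skip : (forall v, unmatched i l v -> ~~ G i v) ->
  greedy_matching i.+1 l.
Proof.
move=> iN; case: gl => ml ul lt ind; split=> // [v /lt /ltnW //|u v].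
rewrite !unmatched_skip => /predU1P[->|uu] /predU1P[->|uv].
- by rewrite intersection_graphE eqxx.
- exact: iN.
- by rewrite intersection_graph_sym; exact: iN.
- exact: ind.
Qed.

Variable j : 'I_n.
Hypotheses (uj : unmatched i l j) (Gij : G i j).

Lemma unmatched_add v :
  unmatched i.+1 (rcons l (i, j)) v = (v != j) && unmatched i l v.
Proof.
rewrite /unmatched edge_set_rcons cover_setU1 !inE !negb_or ltnS leq_eqVlt -!val_eqE /=.
by case: (ltngtP v i); case: (nat_of_ord v == j); rewrite ?andbF.
Qed.

Lemma greedy_matching_add : greedy_matching i.+1 (rcons l (i, j)).
Proof.
case: gl => ml ul lt ind; have /andP[ji j_free] := uj.
have [mij ijl] := is_matchingU1 ml Gij i_free j_free.
split; first by rewrite edge_set_rcons.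
- rewrite /edge_seq map_rcons rcons_uniq ul andbT.
  by move: ijl; rewrite inE.
- move=> v; rewrite edge_set_rcons cover_setU1 !inE -orbA => /or3P[/eqP -> //|/eqP ->|/lt]; last exact: ltnW.
  exact: ltnW.
- move=> u v; rewrite !unmatched_add => /andP[_ uu] /andP[_ uv].
  exact: ind.
Qed.

(** Deleting the key of [j] loses no other unmatched disk, by [indexes_inj]. *)
Lemma indexes_delete t : indexes t i l ->
  indexes t.[~ cell j]%fmap i.+1 (rcons l (i, j)).
Proof.
move=> It k r; rewrite fnd_rem1; split.
  case: eqP => //= kj /It[v [uv vk rv]]; exists v; split=> //.
  by rewrite unmatched_add uv andbT; apply/eqP => vj; apply: kj; rewrite -vk vj.
move=> [v []]; rewrite unmatched_add => /andP[vj uv] vk rv.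
case: eqP => /= [kj|_]; last by apply/It; exists v.
by case/eqP: vj; apply: (indexes_inj It); rewrite // vk.
Qed.

End Step.

(** The insertion overwrites nothing: an unmatched disk in the same cell would be adjacent to
    [i]. *)
Lemma indexes_insert t l (i : 'I_n) : greedy_matching i l ->
  (forall v, unmatched i l v -> ~~ G i v) -> indexes t i l ->
  indexes t.[cell i <- i.+1%:R]%fmap i.+1 l.
Proof.
move=> gl iN It k r; rewrite fnd_set; split.
  case: eqP => [-> [<-]|_ /It[v [uv vk rv]]].
    by exists i; rewrite unmatched_skip // eqxx.
  by exists v; rewrite unmatched_skip // uv orbT.
move=> [v []]; rewrite unmatched_skip // => /predU1P[->|uv] vk ->.
  by rewrite vk eqxx.
case: eqP => [ki|_]; last by apply/It; exists v.
have vi : i != v by rewrite -val_eqE /= gtn_eqF //; case/andP: uv.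
by have /negP[] := iN v uv; apply: same_cell_adjacent; rewrite // vk.
Qed.

Lemma found_unmatched (s : state R) i l o : indexes (tab s 0%N) i l ->
  0 < found s o -> exists2 v, unmatched i l v & found s o = v.+1%:R.
Proof.
move=> It; rewrite /found; case E: (_.[? _])%fmap => [r|] /=; last by rewrite ltxx.
by move/It: E => [v [uv _ ->]]; exists v.
Qed.

Lemma found_cell (s : state R) i l (u v : 'I_n) : indexes (tab s 0%N) i l ->
  reg s 2%N = (tnth D u).1 -> reg s 3%N = (tnth D u).2 -> unmatched i l v ->
  found s ((cell v).1 - (cell u).1, (cell v).2 - (cell u).2) = v.+1%:R.
Proof.
move=> It r2 r3 uv; rewrite /found r2 r3.
have -> : (Num.floor (tnth D u).1 + ((cell v).1 - (cell u).1),
           Num.floor (tnth D u).2 + ((cell v).2 - (cell u).2)) = cell v.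
  by rewrite /cell /key /=; congr (_, _); rewrite addrC subrK.
suff -> : (tab s 0%N).[? cell v]%fmap = Some v.+1%:R by [].
by apply/It; exists v.
Qed.

Definition loads_input (s : state R) : Prop :=
  [/\ reg s 0%N = n%:R, arr s 0%N = [seq c.1 | c <- D] &
      arr s 1%N = [seq c.2 | c <- D]].

Lemma get_centers (s : state R) v : loads_input s ->
  Defs.get (arr s 0%N) v%:R = (tnth D v).1 /\
  Defs.get (arr s 1%N) v%:R = (tnth D v).2.
Proof.
move=> [_ -> ->]; rewrite !get_nat (tnth_nth 0).
by rewrite !(nth_map 0) // size_tuple.
Qed.

(** The list [l] is a ghost variable, visible in the state through arrays 2 and 3 and the table. *)
Definition greedy_inv i (s : state R) : Prop :=
  [/\ loads_input s, reg s 1%N = i%:R &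
      exists l, [/\ greedy_matching i l, indexes (tab s 0%N) i l,
        arr s 2%N = [seq (nat_of_ord p.1)%:R | p <- l] &
        arr s 3%N = [seq (nat_of_ord p.2)%:R | p <- l]]].

Lemma greedy_inv0 : greedy_inv 0 (input D).
Proof.
split=> //; exists [::]; split=> //.
  split=> //.
  - exact: is_matching0.
  - by move=> v /bigcupP[A]; rewrite inE.
by move=> k r; rewrite /= fnd_fmap0; split=> // -[v [/andP[]]].
Qed.

(** Soundness of a probe. The disk found differs from [i] because unmatched disks precede [i]. *)
Lemma hit_adjacent (s : state R) l (i : 'I_n) o : loads_input s ->
  reg s 2%N = (tnth D i).1 -> reg s 3%N = (tnth D i).2 ->
  indexes (tab s 0%N) i l -> hit s o ->
  exists v, [/\ unmatched i l v, found s o = v.+1%:R & G i v].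
Proof.
move=> Is r2 r3 It /andP[/(found_unmatched It)[v uv ->]].
rewrite -natr1 addrK; have [-> ->] := get_centers v Is; rewrite r2 r3 => d4.
exists v; split; rewrite ?natr1 // intersection_graphE d4 andbT.
by rewrite -val_eqE /= gtn_eqF //; case/andP: uv.
Qed.

(** Completeness of a probe, at the offset leading from the cell of [i] to that of [v]. *)
Lemma adjacent_hit (s : state R) l (i v : 'I_n) : loads_input s ->
  reg s 2%N = (tnth D i).1 -> reg s 3%N = (tnth D i).2 ->
  indexes (tab s 0%N) i l -> unmatched i l v -> G i v ->
  hit s ((cell v).1 - (cell i).1, (cell v).2 - (cell i).2).
Proof.
move=> Is r2 r3 It uv Giv; rewrite /hit (found_cell It) // ltr0Sn /=.
rewrite -natr1 addrK; have [-> ->] := get_centers v Is; rewrite r2 r3.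
by move: Giv; rewrite intersection_graphE => /andP[].
Qed.

Lemma greedy_inv_step i s : (i < n)%N -> greedy_inv i s ->
  greedy_inv i.+1 (run step s).
Proof.
move=> lt_in [Is r1 [l [gl It a2 a3]]]; pose w := Ordinal lt_in.
have [gx gy] := get_centers w Is.
(* The state in which the scan starts. *)
pose s0 := run (Seq (Do (Assign 2 (Read 0 (Reg 1))))
  (Seq (Do (Assign 3 (Read 1 (Reg 1)))) (Do (Assign 4 (Const 0))))) s.
have s0E r : (r < 2)%N -> reg s0 r = reg s r by case: r => [|[]].
have [s02 s03] : reg s0 2%N = (tnth D w).1 /\ reg s0 3%N = (tnth D w).2.
  by rewrite -gx -gy /s0 /= /upd /= r1.
have s04 : reg s0 4%N = 0 by [].
have Is0 : loads_input s0 by [].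
have [arr1 tab1 reg1 reg14] := run_scan s0 offsets.
set s1 := run (scan offsets) s0 in arr1 tab1 reg1 reg14.
have -> : run step s = run (Do (Assign 1 (Add (Reg 1) (Const 1))))
  (run (If (Lt (Const 0) (Reg 4)) match_partner
      (Do (Insert 0 (Reg 2) (Reg 3) (Add (Reg 1) (Const 1))))) s1) by [].
have tab1' : tab s1 = tab s by [].
have arr1' : arr s1 = arr s by [].
have r11 : reg s1 1%N = i%:R by rewrite reg1 // s0E.
have r10 : reg s1 0%N = n%:R by rewrite reg1 // s0E //; case: Is.
have r12 : reg s1 2%N = (tnth D w).1 by rewrite reg1.
have r13 : reg s1 3%N = (tnth D w).2 by rewrite reg1.
(* The scanned state becomes opaque, so that simplification does not unfold the 25 probes. *)
move: s1 tab1' arr1' r10 r11 r12 r13 reg14 {arr1 tab1 reg1}.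
move=> s1 tab1 arr1 r10 r11 r12 r13 reg14.
have Is1 : loads_input s1 by case: Is; split; rewrite ?arr1.
case: reg14 => [[x hx r14]|[r14 miss]].
  have [j [uj fj Gwj]] := hit_adjacent Is0 s02 s03 It hx.
  have [jx jy] := get_centers j Is1.
  move: r14; rewrite fj => r14.
  (* Undoes the shift by one of the stored number. *)
  have rj : reg s1 4%N - 1%:~R = j%:R by rewrite r14 -natr1 addrK.
  rewrite [run (If _ _ _) _]/= r14 (ltr0Sn R j) /= /upd /=.
  have Iw := indexes_delete uj It.
  split.
  - by case: Is1.
  - by rewrite /= r11 natr1.
  exists (rcons l (w, j)); split.
  - exact: greedy_matching_add.
  - by rewrite /= -r14 rj jx jy tab1.
  - by rewrite /= arr1 a2 r11 map_rcons.
  - by rewrite /= arr1 a3 -r14 rj map_rcons.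
(* No hit: an unmatched neighbour would have been hit at its own offset, which is among those
   scanned. *)
have iN v : unmatched i l v -> ~~ G w v.
  move=> uv; apply/negP => Gwv; have := miss _ (adjacent_offset Gwv).
  by rewrite (adjacent_hit Is0 s02 s03 It uv Gwv).
rewrite [run (If _ _ _) _]/= r14 s04 ltxx /= /upd /=.
split=> /=.
- by [].
- by rewrite r11 natr1.
exists l; split=> /=.
- exact: (greedy_matching_skip (i := w)).
- rewrite r12 r13 r11 natr1 tab1; exact: (indexes_insert (i := w)).
- by rewrite arr1.
- by rewrite arr1.
Qed.

(** Once [i] is [n], unmatched means uncovered, so the last clause of [greedy_matching] is
    maximality of the matching. *)
Lemma greedy_inv_output (s : state R) : greedy_inv n s ->
  exists B, outputs s B /\ approx_matching (2^-1 : R) G B.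
Proof.
move=> [_ _ [l [[ml ul _ ind] _ a2 a3]]]; exists (edge_set l); split.
  by exists l.
apply: maximal_matching_half => // u v; apply: contraTT; rewrite negb_or.
by move=> /andP[uu uv]; apply: ind; rewrite /unmatched ltn_ord.
Qed.

End Greedy.

Theorem lemma3p1 (R : realType) :
  exists p : cmd, forall kappa : R, exists C : R,
    forall (n : nat) (D : n.-tuple (R * R)), uniq D ->
    exists (t h : nat) (s : state R) (B : {set {set 'I_n}}),
      [/\ exec p (input D) t h s,
          outputs s B,
          approx_matching (2^-1 : R) (intersection_graph D) B
        & forall (d : measure_display) (T : measurableType d)
            (P : probability T R) (X : nat -> {RV P >-> R}),
            hash_costs kappa X -> (0 < n)%N ->
            (expected_time X t h <= (C * n%:R)%:E)%E].
Proof.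
exists greedy => kappa.
pose b := Lt (Reg 1) (Reg 0); pose c := (test_ops b + test_hops b)%N.
(* One round costs at most [c + max_cost step]. The extra [c] pays for the final guard, which
   [0 < n] allows to charge to the factor [n]. *)
exists (Num.max 1 kappa * (c + max_cost step + c)%:R) => n D _.
have Hb i (s : state R) : greedy_inv D i s -> holds s b = (i < n)%N.
  by move=> [[r0 _ _] r1 _]; rewrite /= r0 r1 ltr_nat.
have [//|t [h [s [es Is le_th]]]] := exec_while (p := step) (n := n) _ Hb
  (@greedy_inv_step R n D) (greedy_inv0 D).
have [B [oB aB]] := greedy_inv_output Is.
exists t, h, s, B; split=> // d T P X HX n0.
apply: le_trans (expected_time_le_max t h HX) _.
rewrite lee_fin -mulrA -natrM ler_wpM2l ?le_max ?ler01 // ler_nat.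
apply: leq_trans le_th _; rewrite -/c [leqRHS]mulnDl leq_add2l.
by rewrite leq_pmulr.
Qed.
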